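(* Let $n\ge2$ and $u,v\in A_n^*$. Then $u\ \ddot{\sim}\ v$ if and only if $u\sim_{\mathrm{hypo}_n}v$. Therefore the hypoplactic monoid $\mathrm{hypo}(\mathcal{A}_n)=A_n^*/\ddot{\sim}$ and the classical hypoplactic monoid $\mathrm{hypo}_n=A_n^*/\sim_{\mathrm{hypo}_n}$ are isomorphic monoids.
   Context: Let $A_n=\{1<2<\cdots<n\}$ and $A_n^*$ the free monoid of words over it; $|w|_a$ denotes the number of occurrences of the letter $a$ in $w$. The classical hypoplactic congruence $\sim_{\mathrm{hypo}_n}$ is the monoid congruence on $A_n^*$ generated by the pairs $(yzx,yxz)$ and $(xzy,zxy)$ for $x<y<z$; $(xyx,xxy)$ and $(xyy,yxy)$ for $x<y$; $(xzty,zxyt)$ for $t\le x<y\le z$; and $(ytzx,tyxz)$ for $t<x\le y<z$ (all letters in $A_n$). Quasi-crystal structure on $A_n^*$ (the free quasi-crystal monoid over the standard quasi-crystal of type $\mathfrak{A}_n$, with index set $\{1,\dots,n-1\}$): $\mathrm{wt}(w)=(|w|_1,\dots,|w|_n)\in\mathbb{Z}^n$. For $i\in\{1,\dots,n-1\}$, $w$ has an $i$-inversion if $w=w_1\,i\,w_2\,(i+1)\,w_3$ for some words $w_1,w_2,w_3$. If $w$ has an $i$-inversion then $\ddot{\varepsilon}_i(w)=\ddot{\varphi}_i(w)=+\infty$ and $\ddot{e}_i(w),\ddot{f}_i(w)$ are undefined; otherwise $\ddot{\varepsilon}_i(w)=|w|_{i+1}$, $\ddot{\varphi}_i(w)=|w|_i$,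 $\ddot{e}_i(w)$ is defined iff $|w|_{i+1}>0$ and is obtained by replacing the right-most $i+1$ in $w$ by $i$, and $\ddot{f}_i(w)$ is defined iff $|w|_i>0$ and is obtained by replacing the left-most $i$ in $w$ by $i+1$. The connected component $A_n^*(w)$ of $w$ is the set of words obtained from $w$ by finitely many (defined) applications of the operators $\ddot{e}_i,\ddot{f}_i$. The hypoplactic congruence $\ddot{\sim}$: $u\ddot{\sim}v$ iff there is a bijection $\psi:A_n^*(u)\to A_n^*(v)$ with $\psi(u)=v$ such that for all $x\in A_n^*(u)$ and $i$: $\mathrm{wt}(\psi(x))=\mathrm{wt}(x)$, $\ddot{\varepsilon}_i(\psi(x))=\ddot{\varepsilon}_i(x)$, $\ddot{\varphi}_i(\psi(x))=\ddot{\varphi}_i(x)$, $\ddot{e}_i(\psi(x))$ is defined iff $\ddot{e}_i(x)$ is (and then $\psi(\ddot{e}_i(x))=\ddot{e}_i(\psi(x))$), and likewise for $\ddot{f}_i$. It is a monoid congruence on $A_n^*$. *)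

(* Defs.v *)
From HB Require Import structures.
From mathcomp Require Import all_boot all_algebra.
From mathcomp Require Import boolp classical_sets functions constructive_ereal.

Set Implicit Arguments.
Unset Strict Implicit.
Unset Printing Implicit Defensive.

Local Open Scope quotient_scope.

Import Algebra.

Record congruence (M : monoidType) := Congruence {
  cong_rel :> M -> M -> Prop;
  cong_refl : forall x, cong_rel x x;
  cong_sym : forall x y, cong_rel x y -> cong_rel y x;
  cong_trans : forall y x z, cong_rel x y -> cong_rel y z -> cong_rel x z;
  cong_mul : forall x y x' y',
    cong_rel x y -> cong_rel x' y' -> cong_rel (x * x')%g (y * y')%g
}.

Inductive generated (M : monoidType) (R : M -> M -> Prop) : M -> M -> Prop :=
| gen_base x y : R x y -> generated R x y
| gen_refl x : generated R x x
| gen_sym x y : generated R x y -> generated R y x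
| gen_trans y x z : generated R x y -> generated R y z -> generated R x z
| gen_mul x y x' y' : generated R x y -> generated R x' y' ->
    generated R (x * x')%g (y * y')%g.

Definition generated_congruence (M : monoidType) (R : M -> M -> Prop) :
    congruence M :=
  Congruence (@gen_refl M R) (@gen_sym M R) (@gen_trans M R) (@gen_mul M R).

Section QuotientMonoid.
Variables (M : monoidType) (E : congruence M).

Definition cong_bool (x y : M) : bool := `[< E x y >].

Lemma cong_bool_refl : reflexive cong_bool.
Proof. by move=> x; apply/asboolP/cong_refl. Qed.

Lemma cong_bool_sym : symmetric cong_bool.
Proof. by move=> x y; apply/asboolP/asboolP; apply: cong_sym. Qed.

Lemma cong_bool_trans : transitive cong_bool.
Proof.
by move=> y x z /asboolP Exy /asboolP Eyz; apply/asboolP/(cong_trans Exy).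
Qed.

Definition cong_equiv_rel :=
  EquivRel cong_bool cong_bool_refl cong_bool_sym cong_bool_trans.

Definition quotient : Type := {eq_quot cong_equiv_rel}.
HB.instance Definition _ := Choice.on quotient.
HB.instance Definition _ := EqQuotient.on quotient.

Lemma quotP (x y : M) : \pi_quotient x = \pi_quotient y <-> E x y.
Proof.
split=> [|Exy]; first by move/eqP; rewrite piE => /asboolP.
by apply/eqP; rewrite piE; apply/asboolP.
Qed.

Definition quot_one : quotient := \pi_quotient (1 : M)%g.
Definition quot_mul (x y : quotient) : quotient :=
  \pi_quotient (repr x * repr y)%g.

Lemma quot_mulE (x y : M) :
  quot_mul (\pi_quotient x) (\pi_quotient y) = \pi_quotient (x * y)%g.
Proof. by apply/quotP/cong_mul; apply/quotP; rewrite reprK. Qed.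

Lemma quot_mulA : associative quot_mul.
Proof.
move=> x y z; rewrite -[x]reprK -[y]reprK -[z]reprK.
move: (repr x) (repr y) (repr z) => {x y z} x y z.
by rewrite (quot_mulE x y) (quot_mulE y z) !quot_mulE mulgA.
Qed.

Lemma quot_1mul : left_id quot_one quot_mul.
Proof. by move=> x; rewrite -[x]reprK quot_mulE mul1g. Qed.

Lemma quot_mul1 : right_id quot_one quot_mul.
Proof. by move=> x; rewrite -[x]reprK quot_mulE mulg1. Qed.

HB.instance Definition _ :=
  isMonoid.Build quotient quot_mulA quot_1mul quot_mul1.

End QuotientMonoid.

Definition monoid_isomorphic (M N : monoidType) : Prop :=
  exists f : UMagmaMorphism.type M N, bijective f.

(* The letters 1 < ... < n are represented by the ordinals 0 < ... < n-1, and
   the indices 1, ..., n-1 by the ordinals 0, ..., n-2; the index i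
   corresponds to the pair of consecutive letters (lo i, hi i). *)

Definition word (n : nat) : Type := seq 'I_n.
HB.instance Definition _ n := Choice.on (word n).
HB.instance Definition _ n :=
  isMonoid.Build (word n) (@catA 'I_n) (@cat0s 'I_n) (@cats0 'I_n).

Definition lo n (i : 'I_n.-1) : 'I_n := widen_ord (leq_pred n) i.

Fact hi_subproof n (i : 'I_n.-1) : i.+1 < n.
Proof. by rewrite -ltn_predRL. Qed.

Definition hi n (i : 'I_n.-1) : 'I_n := Ordinal (hi_subproof i).

Section ClassicalHypoplactic.
Variable n : nat.

Inductive hypo_relation : word n -> word n -> Prop :=
| hypo_yzx (x y z : 'I_n) : x < y -> y < z ->
    hypo_relation [:: y; z; x] [:: y; x; z]
| hypo_xzy (x y z : 'I_n) : x < y -> y < z ->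
    hypo_relation [:: x; z; y] [:: z; x; y]
| hypo_xyx (x y : 'I_n) : x < y ->
    hypo_relation [:: x; y; x] [:: x; x; y]
| hypo_xyy (x y : 'I_n) : x < y ->
    hypo_relation [:: x; y; y] [:: y; x; y]
| hypo_xzty (x y z t : 'I_n) : t <= x -> x < y -> y <= z ->
    hypo_relation [:: x; z; t; y] [:: z; x; y; t]
| hypo_ytzx (x y z t : 'I_n) : t < x -> x <= y -> y < z ->
    hypo_relation [:: y; t; z; x] [:: t; y; x; z].

Definition classical_hypo : congruence (word n) :=
  generated_congruence hypo_relation.

Definition classical_hypo_monoid : monoidType := quotient classical_hypo.

End ClassicalHypoplactic.

Section QuasiCrystal.
Variable n : nat.
Implicit Types (w u v x y : word n) (i : 'I_n.-1).

Definition wt w : 'rV[int]_n := \row_a Posz (count_mem a w).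

Definition has_inversion i w : Prop :=
  exists w1 w2 w3 : word n, w = w1 ++ lo i :: w2 ++ hi i :: w3.

Definition qeps i w : \bar int :=
  if `[< has_inversion i w >] then +oo%E
  else (Posz (count_mem (hi i) w))%:E.

Definition qphi i w : \bar int :=
  if `[< has_inversion i w >] then +oo%E
  else (Posz (count_mem (lo i) w))%:E.

Fixpoint replace_leftmost (a b : 'I_n) (w : seq 'I_n) : seq 'I_n :=
  if w is c :: w' then
    if c == a then b :: w' else c :: replace_leftmost a b w'
  else [::].

Definition replace_rightmost (a b : 'I_n) (w : seq 'I_n) : seq 'I_n :=
  rev (replace_leftmost a b (rev w)).

(* [None] means that the operator is undefined. *)
Definition qe i w : option (word n) :=
  if `[< has_inversion i w >] then None
  else if 0 < count_mem (hi i) w then Some (replace_rightmost (hi i) (lo i) w)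
  else None.

Definition qf i w : option (word n) :=
  if `[< has_inversion i w >] then None
  else if 0 < count_mem (lo i) w then Some (replace_leftmost (lo i) (hi i) w)
  else None.

Inductive component w : set (word n) :=
| component_refl : component w w
| component_e i x y : component w x -> qe i x = Some y -> component w y
| component_f i x y : component w x -> qf i x = Some y -> component w y.

(* The two equations with [omap] say that [qe i (psi x)] is defined iff
   [qe i x] is, in which case [psi] sends the latter to the former, and
   likewise for [qf]. *)
Definition preserves_structure (psi : word n -> word n) x : Prop :=
  wt (psi x) = wt x /\
  forall i, [/\ qeps i (psi x) = qeps i x,
                qphi i (psi x) = qphi i x,
                qe i (psi x) = omap psi (qe i x)
              & qf i (psi x) = omap psi (qf i x)].

Definition hypo_equiv u v : Prop :=
  exists psi : word n -> word n,
    [/\ set_bij (component u) (component v) psi,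
        psi u = v
      & forall x, component u x -> preserves_structure psi x].

(* The bijection is determined by its being an injective morphism. *)
Lemma preserves_bij psi u v :
    {in component u &, injective psi} -> psi u = v ->
    (forall x, component u x -> preserves_structure psi x) ->
  set_bij (component u) (component v) psi.
Proof.
move=> psi_inj psi_u psi_pres; split=> // [x|y].
- elim=> [|i {}x y ux vx xy|i {}x y ux vx xy]; first by rewrite psi_u; apply: component_refl.
  + have [_ /(_ i)[_ _ + _]] := psi_pres x ux; rewrite xy /=.
    exact: component_e vx.
  + have [_ /(_ i)[_ _ _ +]] := psi_pres x ux; rewrite xy /=.
    exact: component_f vx.
- elim=> [|i {}y z vy [x ux <-]|i {}y z vy [x ux <-]].
  + by exists u => //; exact: component_refl.
  + have [_ /(_ i)[_ _ -> _]] := psi_pres x ux.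
    case xx': (qe i x) => [x'|] //= [<-]; exists x' => //.
    exact: component_e ux xx'.
  + have [_ /(_ i)[_ _ _ ->]] := psi_pres x ux.
    case xx': (qf i x) => [x'|] //= [<-]; exists x' => //.
    exact: component_f ux xx'.
Qed.

Lemma hypo_equiv_refl u : hypo_equiv u u.
Proof.
have pres x : component u x -> preserves_structure id x.
  by move=> _; split=> // i; split=> //; case: (_ i x).
by exists id; split=> //; apply: preserves_bij => // x y _ _.
Qed.

Lemma hypo_equiv_sym u v : hypo_equiv u v -> hypo_equiv v u.
Proof.
case=> psi [[psi_im psi_inj psi_surj] psi_u psi_pres].
have /choice[phi phiP] y : exists x,
    component v y -> component u x /\ psi x = y.
  have [vy|vy] := pselect (component v y); last by exists y.
  by have [x ux xy] := psi_surj y vy; exists x.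
have phiK x : component u x -> phi (psi x) = x.
  move=> ux; have [ux' eqx] := phiP _ (psi_im x ux).
  by apply: psi_inj => //; rewrite inE.
have phi_v : phi v = u by rewrite -psi_u phiK //; exact: component_refl.
exists phi; have phi_pres y : component v y -> preserves_structure phi y.
  move=> vy; have [ux eqy] := phiP y vy.
  set x := phi y in ux eqy *; have [wt_x pres] := psi_pres x ux.
  rewrite /preserves_structure -/x -eqy wt_x; split=> // i.
  have [-> -> -> ->] := pres i; split=> //.
  - by case xx': (qe i x) => [x'|] //=; rewrite phiK //; apply: component_e xx'.
  - by case xx': (qf i x) => [x'|] //=; rewrite phiK //; apply: component_f xx'.
split=> //; apply: preserves_bij => // y z /set_mem vy /set_mem vz eqyz.
by have [_ <-] := phiP y vy; have [_ <-] := phiP z vz; rewrite eqyz.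
Qed.

Lemma hypo_equiv_trans v u w :
  hypo_equiv u v -> hypo_equiv v w -> hypo_equiv u w.
Proof.
case=> psi [[psi_im psi_inj _] psi_u psi_pres].
case=> phi [[phi_im phi_inj _] phi_v phi_pres].
exists (phi \o psi).
have pres x : component u x -> preserves_structure (phi \o psi) x.
  move=> ux; have [wt1 P1] := psi_pres x ux.
  have [wt2 P2] := phi_pres _ (psi_im x ux).
  split=> [|i] /=; first by rewrite wt2.
  have [e1 f1 E1 F1] := P1 i; have [e2 f2 E2 F2] := P2 i.
  split; rewrite ?e2 ?f2 // ?E2 ?F2 ?E1 ?F1.
  - by case: (qe i x).
  - by case: (qf i x).
split; rewrite /= ?psi_u //; apply: preserves_bij => //=; last by rewrite psi_u.
move=> x y ux uy /phi_inj eqxy; apply: psi_inj => //.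
by apply: eqxy; apply/mem_set/psi_im/set_mem.
Qed.

Lemma has_inversionE i w :
  `[< has_inversion i w >] = subseq [:: lo i; hi i] w.
Proof.
apply/asboolP/idP => [[w1 [w2 [w3 ->]]]|].
  rewrite -[[:: _; _]]cat0s; apply: cat_subseq; first exact: sub0seq.
  by rewrite /= eqxx sub1seq mem_cat inE eqxx orbT.
elim: w => //= c w IHw; have [eqc|_] := eqVneq.
  rewrite sub1seq => /path.splitPr[w2 w3].
  by exists [::], w2, w3; rewrite -eqc.
by case/IHw=> w1 [w2 [w3 ->]]; exists (c :: w1), w2, w3.
Qed.

Lemma has_inversion_cat i x y :
  `[< has_inversion i (x ++ y) >] =
  [|| `[< has_inversion i x >], `[< has_inversion i y >]
    | (lo i \in x) && (hi i \in y)].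
Proof.
rewrite !has_inversionE; elim: x => [|c x IHx] /=; first by rewrite orbF.
rewrite inE; case: (eqVneq c (lo i)) => [_|] /=; last by rewrite IHx.
rewrite !sub1seq mem_cat.
case: (hi i \in x) => //=; case/boolP: (hi i \in y) => [|hy] /=.
  by rewrite orbT.
rewrite orbF; apply/esym/negbTE; apply: contra hy => /mem_subseq; apply.
by rewrite !inE eqxx orbT.
Qed.

Lemma replace_leftmost_cat (a b : 'I_n) x y :
  replace_leftmost a b (x ++ y) =
  if a \in x then replace_leftmost a b x ++ y
  else x ++ replace_leftmost a b y.
Proof.
elim: x => //= c x IHx; rewrite inE; have [//|_] /= := eqVneq c a.
by rewrite IHx; case: ifP.
Qed.

Lemma replace_rightmost_cat (a b : 'I_n) x y :
  replace_rightmost a b (x ++ y) =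
  if a \in y then x ++ replace_rightmost a b y
  else replace_rightmost a b x ++ y.
Proof.
rewrite /replace_rightmost rev_cat replace_leftmost_cat mem_rev.
by case: ifP => _; rewrite rev_cat revK.
Qed.

Lemma size_replace_leftmost (a b : 'I_n) x :
  size (replace_leftmost a b x) = size x.
Proof. by elim: x => //= c x IHx; case: ifP => //= _; rewrite IHx. Qed.

Lemma size_component u x : component u x -> size x = size u.
Proof.
elim=> // i {}x y _ <-; rewrite /qe /qf; do 2!case: ifP => // _.
  by move=> [<-]; rewrite /replace_rightmost size_rev size_replace_leftmost
     size_rev.
by move=> [<-]; rewrite size_replace_leftmost.
Qed.

Lemma qe_cat i x y : qe i (x ++ y) =
  if `[< has_inversion i (x ++ y) >] then None
  else if hi i \in y then omap (cat x) (qe i y) else omap (cat^~ y) (qe i x).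
Proof.
rewrite /qe -!has_count !has_pred1 replace_rightmost_cat mem_cat.
rewrite has_inversion_cat.
case: `[< has_inversion i x >] => //=; case: `[< has_inversion i y >] => //=.
case: ifP => // _; case: (hi i \in y); rewrite ?orbT ?orbF //.
by case: ifP.
Qed.

Lemma qf_cat i x y : qf i (x ++ y) =
  if `[< has_inversion i (x ++ y) >] then None
  else if lo i \in x then omap (cat^~ y) (qf i x) else omap (cat x) (qf i y).
Proof.
rewrite /qf -!has_count !has_pred1 replace_leftmost_cat mem_cat.
rewrite has_inversion_cat.
case: `[< has_inversion i x >] => //=; case: `[< has_inversion i y >] => //=.
by case: ifP => // _; case: (lo i \in x) => //=; case: ifP.
Qed.

Lemma component_cat u u' w : component (u ++ u') w ->
  component u (take (size u) w) /\ component u' (drop (size u) w).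
Proof.
elim=> [|i x y _|i x y _].
- by rewrite take_size_cat // drop_size_cat //; split; apply: component_refl.
- rewrite -{3}(cat_take_drop (size u) x) qe_cat; case=> ux ux'.
  have sz := size_component ux.
  case: ifP => // _; case: ifP => _.
    case E: (qe _ _) => [z|] //= [<-].
    rewrite take_size_cat // drop_size_cat //; split=> //.
    exact: component_e E.
  case E: (qe _ _) => [z|] //= [<-].
  have uz : component u z by exact: component_e E.
  by rewrite take_size_cat ?drop_size_cat // (size_component uz).
- rewrite -{3}(cat_take_drop (size u) x) qf_cat; case=> ux ux'.
  have sz := size_component ux.
  case: ifP => // _; case: ifP => _; last first.
    case E: (qf _ _) => [z|] //= [<-].
    rewrite take_size_cat // drop_size_cat //; split=> //.
    exact: component_f E.
  case E: (qf _ _) => [z|] //= [<-].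
  have uz : component u z by exact: component_f E.
  by rewrite take_size_cat ?drop_size_cat // (size_component uz).
Qed.

Lemma wt_count x y a : wt x = wt y -> count_mem a x = count_mem a y.
Proof. by move/rowP/(_ a); rewrite !mxE => -[]. Qed.

Lemma wt_mem x y : wt x = wt y -> x =i y.
Proof.
by move=> eqxy a; rewrite -!has_pred1 !has_count (wt_count a eqxy).
Qed.

Lemma qeps_inversion i x y : qeps i x = qeps i y ->
  `[< has_inversion i x >] = `[< has_inversion i y >].
Proof. by rewrite /qeps; do 2!case: ifP. Qed.

Lemma hypo_equiv_cat u v u' v' :
  hypo_equiv u v -> hypo_equiv u' v' -> hypo_equiv (u ++ u') (v ++ v').
Proof.
case=> psi [[psi_im psi_inj _] psi_u psi_pres].
case=> phi [[phi_im phi_inj _] phi_u phi_pres].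
pose Psi w := psi (take (size u) w) ++ phi (drop (size u) w) : word n.
have PsiE x y : component u x -> Psi (x ++ y) = psi x ++ phi y.
  move=> /size_component sx.
  by rewrite /Psi take_size_cat ?drop_size_cat.
exists Psi.
have Psi_u : Psi (u ++ u') = v ++ v'.
  by rewrite PsiE ?psi_u ?phi_u //; exact: component_refl.
have pres w : component (u ++ u') w -> preserves_structure Psi w.
  case/component_cat; rewrite -{3}(cat_take_drop (size u) w).
  move: (take _ _) (drop _ _) => x y ux uy.
  have [wtx Px] := psi_pres x ux; have [wty Py] := phi_pres y uy.
  have wtE : wt (Psi (x ++ y)) = wt (x ++ y).
    apply/rowP=> a; rewrite !mxE PsiE // !count_cat.
    by rewrite (wt_count a wtx) (wt_count a wty).
  split=> // i; have [ex _ Ex Fx] := Px i; have [ey _ Ey Fy] := Py i.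
  have invE : `[< has_inversion i (Psi (x ++ y)) >] =
              `[< has_inversion i (x ++ y) >].
    rewrite PsiE // !has_inversion_cat (qeps_inversion ex) (qeps_inversion ey).
    by rewrite (wt_mem wtx) (wt_mem wty).
  split; rewrite ?/qeps ?/qphi ?invE ?(wt_count _ wtE) //.
  - rewrite {1}PsiE // !qe_cat -PsiE // invE (wt_mem wty) Ex Ey.
    case: ifP => // _; case: ifP => _.
      by case: (qe i y) => //= z; rewrite PsiE.
    case E: (qe i x) => [z|] //=; rewrite PsiE //; exact: component_e E.
  - rewrite {1}PsiE // !qf_cat -PsiE // invE (wt_mem wtx) Fx Fy.
    case: ifP => // _; case: ifP => _; last first.
      by case: (qf i y) => //= z; rewrite PsiE.
    case E: (qf i x) => [z|] //=; rewrite PsiE //; exact: component_f E.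
split=> //; apply: preserves_bij => // w z /set_mem uw /set_mem uz.
have [w1 w2] := component_cat uw; have [z1 z2] := component_cat uz.
move=> /eqP; rewrite eqseq_cat; last first.
  by rewrite (size_component (psi_im _ w1)) (size_component (psi_im _ z1)).
case/andP=> /eqP eq1 /eqP eq2.
have {}eq1 := psi_inj _ _ (mem_set w1) (mem_set z1) eq1.
have {}eq2 := phi_inj _ _ (mem_set w2) (mem_set z2) eq2.
by rewrite -(cat_take_drop (size u) w) eq1 eq2 cat_take_drop.
Qed.

Definition hypo : congruence (word n) :=
  Congruence hypo_equiv_refl hypo_equiv_sym hypo_equiv_trans hypo_equiv_cat.

Definition hypo_monoid : monoidType := quotient hypo.

End QuasiCrystal.

(* Main.v *)
(* Both congruences are shown to coincide with the relation [same_inversions]: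
   equal content, and the same inversions between any two letters that are
   consecutive in the support.

   For each defining relation of the classical monoid, one fixed permutation of
   positions is an isomorphism of connected components, because the operators
   preserve the order type (standardization) of a word. Conversely, when no
   letter occurs strictly between a < b, the operators can lower every b to
   a + 1, and the value of epsilon_a then reveals the inversion of a and b.

   Finally, words with the same inversions are classically congruent: the first
   letter of one is brought to the front of the other by swaps of adjacent
   letters a, b, each allowed by a separating letter e that occurs anywhere to
   the left (min(a, b) <= e < max(a, b)) or anywhere to the right
   (min(a, b) < e <= max(a, b)). *)

Require Import Defs.
From mathcomp Require Import all_boot all_algebra.
From mathcomp Require Import boolp classical_sets functions.
From mathcomp Require Import zify.

Set Implicit Arguments.
Unset Strict Implicit.
Unset Printing Implicit Defensive.

(** * Criteria for isomorphism of components *)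

Lemma lo_neq_hi n (i : 'I_n.-1) : (lo i == hi i) = false.
Proof. by apply/eqP=> /(congr1 val) /=; lia. Qed.

Lemma wt_perm n (u v : word n) : (wt u = wt v) <-> perm_eq u v.
Proof.
split=> [uv|/permP uv]; last by apply/rowP=> a; rewrite !mxE uv.
by apply/allP=> a _; apply/eqP/wt_count.
Qed.

(** An inversion makes both operators undefined and both [qeps] and [qphi] infinite, so commutation
    is checked only at the other indices. *)
Lemma preserves_structure_noninverted n (psi : word n -> word n) x :
  perm_eq (psi x) x ->
  (forall i, subseq [:: lo i; hi i] (psi x) = subseq [:: lo i; hi i] x) ->
  (forall i, ~~ subseq [:: lo i; hi i] x ->
     (hi i \in x -> replace_rightmost (hi i) (lo i) (psi x) =
        psi (replace_rightmost (hi i) (lo i) x)) /\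
     (lo i \in x -> replace_leftmost (lo i) (hi i) (psi x) =
        psi (replace_leftmost (lo i) (hi i) x))) ->
  preserves_structure psi x.
Proof.
move=> pe inv rep; split=> [|i]; first exact/wt_perm.
rewrite /qeps /qphi /qe /qf !has_inversionE inv -!has_count !has_pred1.
rewrite !(permP pe) !(perm_mem pe).
case: ifPn => [_|/rep [re rf]]; split=> //; case: ifP => //= xi.
- by rewrite re.
- by rewrite rf.
Qed.

(** [P] may be larger than the component of [u]: closure under the operators suffices, so the
    component never has to be described. *)
Lemma hypo_equiv_invariant n (P : word n -> Prop) (psi : word n -> word n) u :
  injective psi ->
  (forall x, P x -> preserves_structure psi x) ->
  (forall x i, P x -> ~~ subseq [:: lo i; hi i] x ->
     (hi i \in x -> P (replace_rightmost (hi i) (lo i) x)) /\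
     (lo i \in x -> P (replace_leftmost (lo i) (hi i) x))) ->
  P u -> hypo_equiv u (psi u).
Proof.
move=> inj pres clos Pu.
have Pc x : component u x -> P x.
  elim=> // i {}x y _ Px; rewrite /qe /qf has_inversionE -has_count has_pred1;
    case: ifPn => // /(clos x i Px)[]; case: ifP => // xi.
    by move=> /(_ isT) + _ [<-].
  by move=> _ /(_ isT) + [<-].
exists psi; split=> //; last by move=> x /Pc /pres.
by apply: preserves_bij => //= [x y _ _ /inj|x /Pc /pres].
Qed.

(** * The defining relations as permutations of positions *)

Variant letter_spec n (i : 'I_n.-1) (a : 'I_n) : bool -> bool -> Prop :=
| LetterLo of a = lo i : letter_spec i a true false
| LetterHi of a = hi i : letter_spec i a false true
| LetterLess of a < i : letter_spec i a false false
| LetterGreater of i.+1 < a : letter_spec i a false false.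

Lemma letterP n (i : 'I_n.-1) (a : 'I_n) :
  letter_spec i a (a == lo i) (a == hi i).
Proof.
have [->|/eqP al] := eqVneq a (lo i).
  by rewrite lo_neq_hi; constructor.
have [->|/eqP ah] := eqVneq a (hi i); first by constructor.
have: (a : nat) <> i by move=> e; apply: al; apply: val_inj.
have: (a : nat) <> i.+1 by move=> e; apply: ah; apply: val_inj.
move=> h1 h2; case: (ltnP a i) => ai; [exact: LetterLess|apply: LetterGreater].
lia.
Qed.

(** Words of other lengths are fixed, so that this is an involution of all words and hence
    injective. *)
Definition swap12 T (w : seq T) :=
  if w is [:: a; b; c] then [:: a; c; b] else w.
Definition swap01 T (w : seq T) :=
  if w is [:: a; b; c] then [:: b; a; c] else w.
Definition swap01_23 T (w : seq T) :=
  if w is [:: a; b; c; d] then [:: b; a; d; c] else w.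

Lemma swap12K T : involutive (@swap12 T).
Proof. by case=> [|a [|b [|c []]]]. Qed.
Lemma swap01K T : involutive (@swap01 T).
Proof. by case=> [|a [|b [|c []]]]. Qed.
Lemma swap01_23K T : involutive (@swap01_23 T).
Proof. by case=> [|a [|b [|c [|d []]]]]. Qed.


Lemma subseq2_cons (T : eqType) (x y c : T) w :
  subseq [:: x; y] (c :: w) =
  if c == x then y \in w else subseq [:: x; y] w.
Proof. by rewrite /= eq_sym; case: ifP => // _; rewrite sub1seq. Qed.

Ltac expand_letters i :=
  rewrite !subseq2_cons /replace_rightmost /rev /= !inE;
  rewrite ?(eq_sym (hi i)) ?(eq_sym (lo i)) /=.

Ltac split_letters i :=
  repeat match goal with
  | |- context [?a == lo i] => is_var a; case: (letterP i a) => ?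
  | |- context [?a == hi i] => is_var a; case: (letterP i a) => ?
  end.

Ltac letter_lia H := exfalso; move: H; rewrite /lo /hi /=; lia.

Ltac solve_letters i H :=
  expand_letters i; split_letters i => //=; subst => //=; letter_lia H.

Ltac solve_closed i H :=
  expand_letters i; split_letters i => //= _; split=> // _;
  do ?eexists; try reflexivity; subst; move: H; rewrite /lo /hi /=; lia.

(** The pattern, covering both yzx and xyx, is an order type in which equal letters increase from
    right to left. The operators keep it: [a] and [b] cannot become equal because the inversion
    blocks them, and of two equal letters the left one rises first and the right one falls first. *)
Lemma swap12_hypo n (a b c : 'I_n) : c <= a < b ->
  hypo_equiv [:: a; b; c] [:: a; c; b].
Proof.
move=> H; apply: (@hypo_equiv_invariant n
  (fun w => exists a b c : 'I_n, w = [:: a; b; c] /\ c <= a < b)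
  (@swap12 _) [:: a; b; c]); last by exists a, b, c.
- exact: inv_inj (@swap12K _).
- move=> _ [{H} {}a [{}b [{}c [-> H]]]];
  apply: preserves_structure_noninverted => [|i|i].
  + by rewrite /= perm_cons (perm_catC [:: _] [:: _]).
  + solve_letters i H.
  + solve_letters i H.
- by move=> _ i [{H} {}a [{}b [{}c [-> H]]]]; solve_closed i H.
Qed.

Lemma swap01_hypo n (a b c : 'I_n) : a < c <= b ->
  hypo_equiv [:: a; b; c] [:: b; a; c].
Proof.
move=> H; apply: (@hypo_equiv_invariant n
  (fun w => exists a b c : 'I_n, w = [:: a; b; c] /\ a < c <= b)
  (@swap01 _) [:: a; b; c]); last by exists a, b, c.
- exact: inv_inj (@swap01K _).
- move=> _ [{H} {}a [{}b [{}c [-> H]]]];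
  apply: preserves_structure_noninverted => [|i|i].
  + by rewrite (perm_catCA [:: _] [:: _] [:: _]).
  + solve_letters i H.
  + solve_letters i H.
- by move=> _ i [{H} {}a [{}b [{}c [-> H]]]]; solve_closed i H.
Qed.

Lemma swap01_23_a_hypo n (a b c d : 'I_n) : [&& c <= a, a < d & d <= b] ->
  hypo_equiv [:: a; b; c; d] [:: b; a; d; c].
Proof.
move=> H; apply: (@hypo_equiv_invariant n
  (fun w => exists a b c d : 'I_n, w = [:: a; b; c; d] /\
    [&& c <= a, a < d & d <= b])
  (@swap01_23 _) [:: a; b; c; d]); last by exists a, b, c, d.
- exact: inv_inj (@swap01_23K _).
- move=> _ [{H} {}a [{}b [{}c [{}d [-> H]]]]];
  apply: preserves_structure_noninverted => [|i|i].
  + by rewrite (perm_catCA [:: _] [:: _] [:: _; _])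
      !perm_cons (perm_catC [:: _] [:: _]).
  + solve_letters i H.
  + solve_letters i H.
- by move=> _ i [{H} {}a [{}b [{}c [{}d [-> H]]]]]; solve_closed i H.
Qed.

Lemma swap01_23_b_hypo n (a b c d : 'I_n) : [&& b < d, d <= a & a < c] ->
  hypo_equiv [:: a; b; c; d] [:: b; a; d; c].
Proof.
move=> H; apply: (@hypo_equiv_invariant n
  (fun w => exists a b c d : 'I_n, w = [:: a; b; c; d] /\
    [&& b < d, d <= a & a < c])
  (@swap01_23 _) [:: a; b; c; d]); last by exists a, b, c, d.
- exact: inv_inj (@swap01_23K _).
- move=> _ [{H} {}a [{}b [{}c [{}d [-> H]]]]];
  apply: preserves_structure_noninverted => [|i|i].
  + by rewrite (perm_catCA [:: _] [:: _] [:: _; _])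
      !perm_cons (perm_catC [:: _] [:: _]).
  + solve_letters i H.
  + solve_letters i H.
- by move=> _ i [{H} {}a [{}b [{}c [{}d [-> H]]]]]; solve_closed i H.
Qed.


Lemma classical_hypo_hypo n (u v : word n) : classical_hypo n u v -> hypo n u v.
Proof.
elim=> {u v} [u v []|w|u v _|v u w _ uv _ vw|u v u' v' _ uv _].
- by move=> x y z xy yz; apply: swap12_hypo; rewrite (ltnW xy).
- by move=> x y z xy yz; apply: swap01_hypo; rewrite xy ltnW.
- by move=> x y xy; apply: swap12_hypo; rewrite leqnn.
- by move=> x y xy; apply: swap01_hypo; rewrite xy leqnn.
- by move=> x y z t tx xy yz; apply: swap01_23_a_hypo; rewrite tx xy.
- by move=> x y z t tx xy yz; apply: swap01_23_b_hypo; rewrite tx xy.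
- exact: hypo_equiv_refl.
- exact: hypo_equiv_sym.
- exact: hypo_equiv_trans uv vw.
- exact: hypo_equiv_cat.
Qed.

(** * Separating letters and reverse-complement duality *)

Definition separates n (e a b : 'I_n) : bool :=
  (b <= e < a) || (a <= e < b).
Definition separates_dual n (e a b : 'I_n) : bool :=
  (b < e <= a) || (a < e <= b).

(* Reversing both the word and the alphabet exchanges the two notions of
   separation, so only witnesses on the left need to be treated. *)
Definition revcomp n (w : word n) : word n := rev (map (@rev_ord n) w).

Lemma revcompK n : involutive (@revcomp n).
Proof.
move=> w; rewrite /revcomp map_rev revK -map_comp map_id_in //.
by move=> a _ /=; rewrite rev_ordK.
Qed.

Lemma revcomp_cat n (u v : word n) :
  revcomp (u ++ v) = revcomp v ++ revcomp u.
Proof. by rewrite /revcomp map_cat rev_cat. Qed.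

Lemma classical_hypo_base n (u v : word n) :
  hypo_relation u v -> classical_hypo n u v.
Proof. exact: gen_base. Qed.

(** The duality exchanges yzx with xzy and xyx with xyy, reversing the two sides, and maps each of
    the two four-letter families to itself. *)
Lemma classical_hypo_revcomp n (u v : word n) :
  classical_hypo n u v -> classical_hypo n (revcomp u) (revcomp v).
Proof.
have lt (a b : 'I_n) : a < b -> rev_ord b < rev_ord a.
  by move=> /= ab; have := ltn_ord a; have := ltn_ord b; lia.
have le (a b : 'I_n) : a <= b -> rev_ord b <= rev_ord a.
  by move=> /= ab; have := ltn_ord a; have := ltn_ord b; lia.
elim=> {u v} [u v []|w|u v _|v u w _ uv _ vw|u v u' v' _ uv _ uv'].
- by move=> x y z xy yz;
  apply/cong_sym/classical_hypo_base; apply: hypo_xzy; apply: lt.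
- by move=> x y z xy yz;
  apply/cong_sym/classical_hypo_base; apply: hypo_yzx; apply: lt.
- by move=> x y xy;
  apply/cong_sym/classical_hypo_base; apply: hypo_xyy; apply: lt.
- by move=> x y xy;
  apply/cong_sym/classical_hypo_base; apply: hypo_xyx; apply: lt.
- by move=> x y z t tx xy yz; apply: classical_hypo_base;
  apply: hypo_xzty; [apply: le|apply: lt|apply: le].
- by move=> x y z t tx xy yz; apply: classical_hypo_base;
  apply: hypo_ytzx; [apply: lt|apply: le|apply: lt].
- exact: cong_refl.
- exact: cong_sym.
- exact: cong_trans uv vw.
- by rewrite !revcomp_cat; apply: cong_mul.
Qed.

Lemma has_split_first (T : Type) (P : pred T) s : has P s ->
  exists s1 m s2, [/\ s = s1 ++ m :: s2, P m & ~~ has P s1].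
Proof.
elim: s => //= c s IHs.
case: (boolP (P c)) => [Pc _|nPc /IHs[s1 [m [s2 [-> Pm ns1]]]]].
  by exists [::], c, s.
by exists (c :: s1), m, s2; split; rewrite //= negb_or nPc.
Qed.

(** * Swaps of adjacent letters with a distant separating letter *)

Section LocalSwaps.
Variable n : nat.
Implicit Types (p s u v w M W : word n) (a b c d e g h l x : 'I_n).

Local Notation "u ~ v" := (classical_hypo n u v) (at level 70).

Lemma hypo_trans v u w : u ~ v -> v ~ w -> u ~ w.
Proof. exact: cong_trans. Qed.

Lemma hypo_catl p u v : u ~ v -> p ++ u ~ p ++ v.
Proof. by move=> uv; apply: (cong_mul (cong_refl _ p) uv). Qed.

Lemma hypo_catr s u v : u ~ v -> u ++ s ~ v ++ s.
Proof. by move=> uv; apply: (cong_mul uv (cong_refl _ s)). Qed.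

Lemma hypo_cons c u v : u ~ v -> c :: u ~ c :: v.
Proof. exact: (@hypo_catl [:: c]). Qed.

(** The bound [k] on the gap between the separating letter and the swapped pair is the induction
    parameter. *)
Definition swappable_after k := forall M e a b s, size M < k ->
  separates e a b -> e :: M ++ a :: b :: s ~ e :: M ++ b :: a :: s.

Definition swappable_before k := forall M e a b s, size M < k ->
  separates_dual e a b -> a :: b :: M ++ e :: s ~ b :: a :: M ++ e :: s.

Lemma swappable_dual k : swappable_after k -> swappable_before k.
Proof.
move=> hA M e a b s szM sep.
have E c d : c :: d :: M ++ e :: s =
    revcomp (revcomp s ++ rev_ord e :: revcomp M ++ [:: rev_ord d; rev_ord c]).
  rewrite -[LHS]revcompK; congr revcomp.
  by rewrite /revcomp /= map_cat /= !rev_cons rev_cat rev_cons -!cats1 -!catA.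
rewrite !E; apply/classical_hypo_revcomp/hypo_catl/hA.
  by rewrite /revcomp size_rev size_map.
move: sep (ltn_ord a) (ltn_ord b) (ltn_ord e).
by rewrite /separates /separates_dual /=; lia.
Qed.

Lemma swappable_sym k :
  (forall M e d x s, size M < k -> x <= e < d ->
     e :: M ++ d :: x :: s ~ e :: M ++ x :: d :: s) -> swappable_after k.
Proof.
move=> h M e a b s szM /orP[/h|/h]; first exact.
by move=> ba; apply/cong_sym/ba.
Qed.

Lemma swappable_after1 : swappable_after 1.
Proof.
apply: swappable_sym => -[] // e d x s _ /andP[xe ed] /=.
apply: (@hypo_catr s [:: _; _; _] [:: _; _; _]); apply: classical_hypo_base.
move: xe; rewrite leq_eqVlt => /orP[/eqP/val_inj -> |xe]; first exact: hypo_xyx.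
exact: hypo_yzx.
Qed.

(** If [g] does not separate [d] and [x] itself, a four-letter relation swaps [d], [x] together with
    [e], [g]; a three-letter relation, with [x] or [d] as the separating letter, compensates for the
    swap of [e] and [g]. *)
Lemma swappable_after2 : swappable_after 2.
Proof.
have hA := swappable_after1; have hB := swappable_dual hA.
apply: swappable_sym => -[e d x s _ xed|g [] // e d x s _ xed] /=.
  by apply: (hA [::]); rewrite // /separates xed.
have /andP[xe ed] := xed.
case: (ltnP g x) => gx; last case: (ltnP g d) => gd.
- have sep : separates_dual x e g by rewrite /separates_dual gx xe.
  apply: (hypo_trans (v := [:: g, e, x, d & s])); last first.
    by apply/cong_sym; apply: (hB [::]).
  apply: (@hypo_catr s [:: _; _; _; _] [:: _; _; _; _]);
    apply: classical_hypo_base.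
  exact: hypo_ytzx.
- by apply: hypo_cons; apply: (hA [::]); rewrite // /separates gx gd.
- have sep : separates_dual d e g by rewrite /separates_dual ed gd orbT.
  apply: (hypo_trans (v := [:: g, e, d, x & s])); first exact: (hB [::]).
  apply/cong_sym.
  apply: (@hypo_catr s [:: _; _; _; _] [:: _; _; _; _]);
    apply: classical_hypo_base.
  exact: hypo_xzty.
Qed.

(** [c] crosses the last letter of [M] first, over a gap one letter shorter than [W ++ M]; this is
    why [<= k] is enough. *)
Lemma pass_left k W M e c s : swappable_after k -> size W + size M <= k ->
  {in M, forall a, separates e a c} ->
  e :: W ++ M ++ c :: s ~ e :: W ++ c :: M ++ s.
Proof.
move=> hA; elim/last_ind: M s => [|M a IHM] s.
  by move=> *; apply: cong_refl.
rewrite size_rcons -cats1 -!catA /= => szM sep.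
apply: (hypo_trans (v := e :: (W ++ M) ++ [:: c, a & s])).
  rewrite catA; apply: hA; first by rewrite size_cat; lia.
  by apply: sep; rewrite mem_cat inE eqxx orbT.
rewrite -catA; apply: IHM => [|b bM]; first lia.
by apply: sep; rewrite mem_cat bM.
Qed.

(** The gap [h :: l :: M] may have length [k], one too many for [hA]. Moving [e] past [h] shortens
    it. After the swap [d] is one place further away, so [l] is first carried to the left of [h] and
    [e] before these are exchanged back. *)
Lemma swap_mixed k M e h l d x s :
  swappable_after k -> swappable_before k -> (size M).+1 < k ->
  x <= e -> e < d -> d <= h -> l < x ->
  [:: e, h, l & M ++ [:: d, x & s]] ~ [:: e, h, l & M ++ [:: x, d & s]].
Proof.
move=> hA hB szM xe ed dh lx.
have seh : separates_dual d e h by rewrite /separates_dual; lia.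
have she : separates_dual d h e by rewrite /separates_dual; lia.
have sel : separates_dual x e l by rewrite /separates_dual; lia.
have sle : separates_dual x l e by rewrite /separates_dual; lia.
have shl : separates_dual x h l by rewrite /separates_dual; lia.
have sed : separates e d x by rewrite /separates; lia.
have selh : separates e l h by rewrite /separates; lia.
have szM' := ltnW szM.
apply: (hypo_trans (v := [:: h, e, l & M ++ [:: d, x & s]])).
  exact: (hB (l :: M)).
apply: (hypo_trans (v := [:: h, e, l & M ++ [:: x, d & s]])).
  by apply: hypo_cons; apply: (hA (l :: M)).
apply: (hypo_trans (v := [:: h, l, e & M ++ [:: x, d & s]])).
  by apply: hypo_cons; apply: (hB M).
apply: (hypo_trans (v := [:: l, h, e & M ++ [:: x, d & s]])).
  exact: (hB (e :: M)).
apply: (hypo_trans (v := [:: l, e, h & M ++ [:: x, d & s]])).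
  apply: hypo_cons; rewrite -(cat_rcons x); apply: hB => //.
  by rewrite size_rcons.
apply: (hypo_trans (v := [:: e, l, h & M ++ [:: x, d & s]])).
  exact: (hB (h :: M)).
by apply: (hA [::]) => //=; lia.
Qed.

(* Induction on the distance to the separating letter [e]. Write [M = g :: M'].
   Either a letter of [M] is itself separating, or one of [M'] lets [e] jump over
   [g], or letters [< x] and [>= d] both occur (and [swap_mixed] applies),
   or [g] separates all of [M'] from both [d] and [x]. *)
Lemma swappable_step k : 1 < k -> swappable_after k -> swappable_after k.+1.
Proof.
move=> k1 hA; have hB := swappable_dual hA.
apply: swappable_sym => M e d x s.
rewrite ltnS leq_eqVlt => /orP[/eqP szM|szM] xed; last first.
  by apply: hA; rewrite // /separates xed.
have /andP[xe ed] := xed.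
have [/hasP[m]|/hasPn noM] := boolP (has (fun m : 'I_n => x <= m < d) M).
  move=> /path.splitPr mM; case: mM szM => M1 M2 szM xmd.
  rewrite -!catA /=; apply: hypo_cons; apply: hypo_catl; apply: hA.
    by move: szM; rewrite size_cat /=; lia.
  by rewrite /separates xmd.
case: M szM noM => [|g M] //= szM noM; first by move: k1; rewrite -szM.
have [/hasP[m mM sep]|/hasPn noD] :=
    boolP (has (fun m : 'I_n => separates_dual m e g) M).
  have EB t : [:: e, g & M ++ t] ~ [:: g, e & M ++ t].
    case/path.splitPr: mM szM => M1 M2; rewrite size_cat /= => szM.
    by rewrite -!catA /=; apply: hB => //; lia.
  apply: hypo_trans (EB _) (hypo_trans _ (cong_sym (EB _))).
  by apply: hypo_cons; apply: hA; [lia|rewrite /separates xed].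
have [mixed|/hasPn same] := boolP (has (fun m : 'I_n => (m < x) != (g < x)) M).
  have [M1 [m [M2 [EM gm /hasPn noM1]]]] := has_split_first mixed.
  have noX c : c \in g :: M -> c < x \/ d <= c.
    by move=> /noM; lia.
  (* The letters of [M1] lie on the same side of [e] as [g], and [m] on the other, so [e] lets [m]
     cross them and arrive next to [g]. *)
  have Eg t : [:: e, g & M ++ t] ~ [:: e, g, m & M1 ++ M2 ++ t].
    rewrite EM -catA /=; apply: (@pass_left k [:: g]) => //.
      by move: szM; rewrite EM size_cat /=; lia.
    move=> c cM1; have := noM1 c cM1.
    have := noX g; have := noX c; have := noX m.
    rewrite EM !inE !mem_cat !inE cM1 !eqxx !orbT.
    by rewrite /separates; lia.
  (* Used when [g < x], to put the letter [>= d] before the letter [< x] as in [swap_mixed]. *)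
  have Em t : [:: e, g, m & t] ~ [:: e, m, g & t].
    apply: (hA [::]); first exact: ltnW.
    have := noX g; have := noX m.
    rewrite EM !inE !mem_cat !inE !eqxx !orbT.
    by rewrite /separates; lia.
  apply: hypo_trans (Eg _) (hypo_trans _ (cong_sym (Eg _))).
  rewrite !catA.
  have szM12 : (size (M1 ++ M2)).+1 < k.
    by move: szM; rewrite EM !size_cat /=; lia.
  have := noX g; have := noX m.
  rewrite EM !inE !mem_cat !inE !eqxx !orbT => /(_ isT) hm /(_ isT) hg.
  case: (ltnP g x) => gx; last by apply: (swap_mixed _ hA hB szM12); lia.
  apply: hypo_trans (Em _) (hypo_trans _ (cong_sym (Em _))).
  by apply: (swap_mixed _ hA hB szM12); lia.
(* Here every [c] in [M] satisfies [c <= g] if [g < x], and [g < c] if [d <= g]. *)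
have sepM y : y = d \/ y = x -> {in M, forall c, separates g c y}.
  move=> yE c cM; have := noD c cM; have := same c cM; have := noM c.
  have := noM g; rewrite !inE eqxx cM orbT /separates_dual /separates.
  by case: yE => ->; lia.
have sd := sepM d (or_introl erefl); have sx := sepM x (or_intror erefl).
apply: (hypo_trans (v := [:: e, g, d & M ++ x :: s])).
  by apply: hypo_cons; apply: (@pass_left k [::]) => //=; lia.
apply: (hypo_trans (v := [:: e, g, d, x & M ++ s])).
  by apply: hypo_cons; apply: (@pass_left k [:: d]) => //=; lia.
(* Only [g] is left in the gap, which [1 < k] allows. *)
apply: (hypo_trans (v := [:: e, g, x, d & M ++ s])).
  by apply: (hA [:: g]); rewrite // /separates xed.
apply/cong_sym; apply: (hypo_trans (v := [:: e, g, x & M ++ d :: s])).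
  by apply: hypo_cons; apply: (@pass_left k [::]) => //=; lia.
by apply: hypo_cons; apply: (@pass_left k [:: x]) => //=; lia.
Qed.

Lemma swappable_afterT k : swappable_after k.
Proof.
case: k => [M //|k]; elim: k => [|[|k] IHk]; first exact: swappable_after1.
  exact: swappable_after2.
exact: swappable_step.
Qed.

Lemma swappable_beforeT k : swappable_before k.
Proof. exact/swappable_dual/swappable_afterT. Qed.

End LocalSwaps.

(** * Inversions are invariants of the hypoplactic congruence *)

Lemma component_trans n (u v w : word n) :
  component u v -> component v w -> component u w.
Proof.
move=> uv; elim=> // i x y _ ux; [exact: component_e|exact: component_f].
Qed.

Lemma hypo_equiv_qe n i (u v u' : word n) : qe i u = Some u' ->
  hypo_equiv u v -> exists2 v', qe i v = Some v' & hypo_equiv u' v'.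
Proof.
move=> uu' [psi [[_ inj _] psi_u pres]].
have uc : component u u' by apply: component_e uu'; apply: component_refl.
exists (psi u').
  by have [_ /(_ i)[_ _]] := pres u (component_refl u); rewrite psi_u uu'.
have pres' x : component u' x -> preserves_structure psi x.
  by move=> u'x; apply: pres; apply: component_trans uc u'x.
exists psi; split=> //; apply: preserves_bij => //.
move=> x y /set_mem u'x /set_mem u'y.
by apply: inj; apply/mem_set/(component_trans uc).
Qed.

Lemma replace_rightmost_split n (a b : 'I_n) (w : word n) : a \in w ->
  exists w1 w2, [/\ w = w1 ++ a :: w2, a \notin w2 &
    replace_rightmost a b w = w1 ++ b :: w2].
Proof.
rewrite -mem_rev -has_pred1 => /has_split_first[s1 [m [s2 [E /eqP Em ns1]]]].
rewrite {m}Em in E; rewrite has_pred1 in ns1; exists (rev s2), (rev s1).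
have Ew : w = rev s2 ++ a :: rev s1.
  by rewrite -[w]revK E rev_cat rev_cons -cats1 -catA.
split; rewrite ?mem_rev // Ew replace_rightmost_cat inE eqxx /=.
rewrite (replace_rightmost_cat a b [:: a]) mem_rev (negbTE ns1).
by rewrite /replace_rightmost /= eqxx.
Qed.

Definition lower n (i : 'I_n.-1) (a : 'I_n) : 'I_n :=
  if a == hi i then lo i else a.

(* When [u] has no i-inversion, [map (lower i) u] is the result of applying [qe i]
   as often as possible. *)
Lemma hypo_equiv_lower n i (u v : word n) : ~~ subseq [:: lo i; hi i] u ->
  hypo_equiv u v -> hypo_equiv (map (lower i) u) (map (lower i) v).
Proof.
have low_id (w : word n) : hi i \notin w -> map (lower i) w = w.
  move=> hw; apply: map_id_in => a aw; rewrite /lower; case: eqP => // ah.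
  by rewrite -ah aw in hw.
have [k] := ubnP (count_mem (hi i) u); elim: k u v => // k IHk u v.
rewrite ltnS => szu inv uv.
have wt_uv : wt v = wt u.
  by case: uv => psi [_ <- /(_ _ (component_refl u))[]].
have [hu|hu] := boolP (hi i \in u); last first.
  by rewrite !low_id // (wt_mem wt_uv).
have qeE (w : word n) w' : qe i w = Some w' ->
    map (lower i) w' = map (lower i) w.
  rewrite /qe; case: ifP => // _; rewrite -has_count has_pred1.
  case: ifP => // hw [<-].
  have [w1 [w2 [-> _ ->]]] := replace_rightmost_split (lo i) hw.
  by rewrite !map_cat /= /lower eqxx lo_neq_hi.
have [w1 [w2 [Eu hw2 Er]]] := replace_rightmost_split (lo i) hu.
have uu' : qe i u = Some (replace_rightmost (hi i) (lo i) u).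
  by rewrite /qe has_inversionE (negbTE inv) -has_count has_pred1 hu.
have [v' vv' uv'] := hypo_equiv_qe uu' uv.
rewrite -(qeE _ _ uu') -(qeE _ _ vv'); apply: IHk => //.
  apply: leq_trans szu; rewrite Er Eu !count_cat /= eqxx lo_neq_hi; lia.
(* The new [lo i] creates no inversion, since no [hi i] stands to its right. *)
move: inv; rewrite Er Eu -!has_inversionE !has_inversion_cat.
move=> /norP[inv1 /norP[_]]; rewrite inE eqxx andbT => lw1.
by rewrite (negbTE inv1) (negbTE lw1) has_inversionE subseq2_cons eqxx
  (negbTE hw2).
Qed.

(** In the absence of [lo i], lowering merely renames [hi i], without merging letters. *)
Lemma subseq2_lower n i a (w : word n) : lo i \notin w ->
  a != lo i -> a != hi i ->
  subseq [:: a; lo i] (map (lower i) w) = subseq [:: a; hi i] w.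
Proof.
move=> + al ah; have mem_lower (w' : word n) : lo i \notin w' ->
    (lo i \in map (lower i) w') = (hi i \in w').
  elim: w' => //= c w' IHw; rewrite !inE negb_or => /andP[lc /IHw ->].
  rewrite /lower (eq_sym (hi i)).
  case: (eqVneq c (hi i)) => _; first by rewrite eqxx.
  by rewrite (negbTE lc).
elim: w => // c w IHw; rewrite inE negb_or => /andP[lc lw].
rewrite map_cons !subseq2_cons IHw // mem_lower //.
have -> // : (lower i c == a) = (c == a).
rewrite /lower; case: (eqVneq c (hi i)) => // ->.
by rewrite !(eq_sym _ a) (negbTE al) (negbTE ah).
Qed.

Definition same_inversions n (u v : word n) : Prop :=
  perm_eq u v /\ forall a b : 'I_n, a < b ->
    (forall c : 'I_n, c \in u -> ~~ (a < c < b)) ->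
    subseq [:: a; b] u = subseq [:: a; b] v.

Lemma same_inversions_trans n (v u w : word n) :
  same_inversions u v -> same_inversions v w -> same_inversions u w.
Proof.
move=> [uv invuv] [vw invvw]; split=> [|a b ab nu]; first exact: perm_trans vw.
by rewrite invuv // invvw // => c; rewrite -(perm_mem uv); apply: nu.
Qed.

Lemma hypo_same_inversions n (u v : word n) : hypo n u v -> same_inversions u v.
Proof.
move=> uv; have wtE (u' v' : word n) : hypo_equiv u' v' -> wt v' = wt u'.
  by case=> psi [_ <- /(_ _ (component_refl u'))[]].
split=> [|a b ab nu]; first exact/wt_perm/esym/wtE.
have [k] := ubnP (b - a); elim: k b u v ab uv nu => // k IHk b u v ab uv nu.
rewrite ltnS => bak.
(* The index with upper letter [b]. Unless its lower letter is [a], that letter is absent from [u],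
   and lowering reduces [b - a] by one. *)
have bn : b.-1 < n.-1 by move: (ltn_ord b); lia.
pose i : 'I_n.-1 := Ordinal bn.
have hib : hi i = b by apply: val_inj => /=; lia.
have [lo_a|lo_a] := eqVneq (lo i) a.
  case: uv => psi [_ <- /(_ _ (component_refl u))[_ /(_ i)]].
  case=> [/qeps_inversion + _ _ _].
  by rewrite !has_inversionE lo_a hib.
have aloi : a < lo i.
  rewrite ltn_neqAle; apply/andP; split; first by rewrite eq_sym.
  by rewrite /=; lia.
have lou : lo i \notin u.
  by apply/negP => /nu; rewrite aloi /=; lia.
have lov : lo i \notin v by rewrite (wt_mem (wtE _ _ uv)).
have ah : a != hi i by rewrite hib neq_ltn ab.
rewrite -hib -!subseq2_lower // 1?eq_sym //; apply: IHk => //.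
- apply: hypo_equiv_lower uv; apply: contra lou => /mem_subseq; apply.
  by rewrite inE eqxx.
- move=> c /mapP[c' /nu nc' ->]; rewrite /lower; case: ifP => _.
    by rewrite ltnn andbF.
  by apply: contra nc' => /andP[-> /=]; lia.
- by rewrite /=; lia.
Qed.

(** * From equal inversions to classical congruence *)

Lemma subseq2_catl (T : eqType) (a b : T) s t : a \notin s ->
  subseq [:: a; b] (s ++ t) = subseq [:: a; b] t.
Proof.
elim: s => // c s IHs; rewrite inE negb_or eq_sym => /andP[/negbTE ca /IHs <-].
by rewrite subseq2_cons ca.
Qed.

Lemma adjacent_swap n (p s : word n) (a b : 'I_n) :
  has (fun e => separates e a b) p || has (fun e => separates_dual e a b) s ->
  classical_hypo n (p ++ a :: b :: s) (p ++ b :: a :: s).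
Proof.
case/orP=> /hasP[e /path.splitPr[s1 s2] sep].
  by rewrite -!catA; apply: hypo_catl; apply: swappable_afterT sep.
by apply: hypo_catl; apply: swappable_beforeT sep.
Qed.

(** If [x] could not be swapped with the letter [g] before it, the two would be consecutive in the
    support and inverted in only one of the two words. *)
Lemma move_to_front n (p u v1 v2 : word n) (x : 'I_n) : x \notin v1 ->
  same_inversions (p ++ x :: u) (p ++ v1 ++ x :: v2) ->
  classical_hypo n (p ++ v1 ++ x :: v2) (p ++ x :: v1 ++ v2).
Proof.
elim/last_ind: v1 v2 => [|v1 g IHv1] v2; first by move=> _ _; apply: cong_refl.
rewrite mem_rcons inE negb_or => /andP[xg xv1]; rewrite !cat_rcons => sim.
suff st : classical_hypo n (p ++ v1 ++ g :: x :: v2) (p ++ v1 ++ x :: g :: v2).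
  (* The swap keeps the inversions because classical congruence implies hypoplactic equivalence. *)
  apply: (cong_trans st (IHv1 _ xv1 (same_inversions_trans sim _))).
  by apply: hypo_same_inversions; apply: classical_hypo_hypo.
rewrite !catA; apply: adjacent_swap; case: sim => perm inv.
apply: contraT; rewrite negb_or => /andP[/hasPn sepP /hasPn sepS].
have permu : perm_eq (x :: u) (v1 ++ [:: g, x & v2]).
  by move: perm; rewrite perm_cat2l.
have nc (c : 'I_n) : c \in p ++ x :: u -> ~~ (x < c < g) && ~~ (g < c < x).
  rewrite (perm_mem perm) catA mem_cat !inE.
  by case/or4P=> [/sepP|/eqP ->|/eqP ->|/sepS];
    rewrite /separates /separates_dual; lia.
have [xltg|gltx|/val_inj xeg] := ltngtP x g; last by rewrite xeg eqxx in xg.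
(* [x] precedes [g] in the first word; in the second, all [x] come after all [g]. *)
- have xP : x \notin p ++ v1.
    by apply/negP => /sepP; rewrite /separates; lia.
  have gS : g \notin v2.
    by apply/negP => /sepS; rewrite /separates_dual; lia.
  have xp : x \notin p by move: xP; rewrite mem_cat negb_or => /andP[].
  have gu : g \in u.
    have: g \in x :: u by rewrite (perm_mem permu) mem_cat inE eqxx orbT.
    by rewrite inE eq_sym (negbTE xg).
  have := inv x g xltg (fun c cu => proj1 (andP (nc c cu))).
  rewrite subseq2_catl // subseq2_cons eqxx gu catA subseq2_catl //.
  by rewrite !subseq2_cons eqxx eq_sym (negbTE xg) (negbTE gS).
(* [g] precedes [x] in the second word; in the first, [g] is absent from [p] and [x] from [u]. *)
- have gP : g \notin p ++ v1.
    by apply/negP => /sepP; rewrite /separates; lia.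
  have xS : x \notin v2.
    by apply/negP => /sepS; rewrite /separates_dual; lia.
  have gp : g \notin p by move: gP; rewrite mem_cat negb_or => /andP[].
  have xu : x \notin u.
    have: perm_eq (x :: u) (x :: v1 ++ g :: v2).
      by apply/permP => P; rewrite (permP permu) /= !count_cat /=; lia.
    rewrite perm_cons => /perm_mem ->.
    by rewrite mem_cat inE !negb_or xv1 xg.
  have := inv g x gltx (fun c cu => proj2 (andP (nc c cu))).
  rewrite subseq2_catl // subseq2_cons (negbTE xg) catA subseq2_catl //.
  rewrite subseq2_cons eqxx inE eqxx /= => /mem_subseq/(_ x).
  by rewrite !inE eqxx orbT (negbTE xu) => /(_ isT).
Qed.

(** Settled letters stay in the prefix [p], since they may serve as separating letters for later
    swaps. *)
Lemma same_inversions_classical_hypo n (p u v : word n) :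
  same_inversions (p ++ u) (p ++ v) -> classical_hypo n (p ++ u) (p ++ v).
Proof.
elim: u p v => [|x u IHu] p v sim.
  have := perm_size sim.1; rewrite !size_cat /= => /eqP.
  by rewrite eqn_add2l eq_sym size_eq0 => /eqP ->; apply: gen_refl.
have: has (pred1 x) v.
  have := sim.1; rewrite perm_cat2l has_pred1 => /perm_mem <-.
  by rewrite inE eqxx.
move=> /has_split_first[v1 [m [v2 [Ev /eqP Em]]]]; rewrite has_pred1 => xv1.
rewrite {}Ev {m}Em in sim *.
have vE := move_to_front xv1 sim.
apply: cong_trans (cong_sym vE).
rewrite -!(cat_rcons x p); apply: IHu; rewrite !cat_rcons.
apply: same_inversions_trans sim _.
by apply: hypo_same_inversions; apply: classical_hypo_hypo.
Qed.

(** * Isomorphism of the quotient monoids *)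

(** Equality of the records makes the two quotients the same monoid, so the identity is the
    isomorphism. *)
Lemma congruence_ext (M : monoidType) (E F : congruence M) :
  (forall x y, E x y <-> F x y) -> E = F.
Proof.
case: E F => [r r1 r2 r3 r4] [t t1 t2 t3 t4] /= rt.
have {}rt : r = t by apply/funext=> x; apply/funext=> y; apply/propext.
by case: t / rt t1 t2 t3 t4 => *; congr Congruence; apply: Prop_irrelevance.
Qed.

Theorem theorem8p6 (n : nat) (hn : 2 <= n) :
  (forall u v : word n, hypo n u v <-> classical_hypo n u v) /\
  monoid_isomorphic (hypo_monoid n) (classical_hypo_monoid n).
Proof.
have hypoE (u v : word n) : hypo n u v <-> classical_hypo n u v.
  split; last exact: classical_hypo_hypo.
  by move/hypo_same_inversions; apply: (@same_inversions_classical_hypo n [::]).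
split=> //; rewrite /hypo_monoid (congruence_ext hypoE).
by exists idfun; exists idfun.
Qed.
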